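(* For every $k\ge 2$: $V(I_k)$ has exactly $k-1$ irreducible components, each of dimension $3k-2$. The components can be indexed by $j=2,\dots,k$ so that the component indexed $j$ involves exactly the first $j$ coordinate blocks $\overline v_1,\dots,\overline v_j$ and none of the later blocks $\overline v_{j+1},\dots,\overline v_k$.
   Context: $\mathbb F$ is a field of characteristic $\neq 2$, with fixed algebraic closure $\overline{\mathbb F}$. For $k\ge 2$, $R_k$ is the polynomial ring over $\mathbb F$ in the $3k$ variables $v_{i,c}$ ($1\le i\le k$, $c=1,2,3$), and $\overline v_i=(v_{i,1},v_{i,2},v_{i,3})$ is the $i$-th coordinate block. Let $S=\mathrm{diag}(-1,-1,1)$ and let $a\times b=(a_2b_3-a_3b_2,\;a_3b_1-a_1b_3,\;a_1b_2-a_2b_1)$ be the cross product. Define recursively $\overline w_2=\overline v_1\times\overline v_2$ and $\overline w_j=S(\overline w_{j-1})\times\overline v_j$ for $j\ge 3$. $I_k\subset R_k$ is the ideal generated by the three components of $\overline w_k$. $V(I_k)$ is the vanishing locus of $I_k$ in $\mathbb A^{3k}(\overline{\mathbb F})$, and irreducible components are taken there. A closed subset $Z\subseteq\mathbb A^{3k}(\overline{\mathbb F})$ is said to involve the block $\overline v_i$ if it is not a union of fibres of the projection $\mathbb A^{3k}\to\mathbb A^{3(k-1)}$ forgetting $\overline v_i$ (i.e. membership in $Z$ depends on $\overline v_i$). *)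

(* Defs.v *)
From mathcomp Require Import all_boot all_order all_algebra.
From mathcomp Require Import boolp classical_sets functions cardinality.
From mathcomp Require Import mpoly.

Set Implicit Arguments.
Unset Strict Implicit.
Unset Printing Implicit Defensive.

Import GRing.Theory.
Local Open Scope classical_set_scope.
Local Open Scope ring_scope.

Section Geometry.
Variables (L : fieldType) (n : nat).
Implicit Types (X Y Z V : set 'rV[L]_n).

Definition zero_locus (J : set {mpoly L[n]}) : set 'rV[L]_n :=
  [set x | forall p, J p -> p.@[x 0] = 0].

Definition zariski_closed Z := exists J, Z = zero_locus J.

Definition closed_in Z Y := exists2 A, zariski_closed A & Y = Z `&` A.

Definition irreducible Z :=
  Z !=set0 /\
  forall A B, closed_in Z A -> closed_in Z B -> Z = A `|` B -> Z = A \/ Z = B.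

Definition irreducible_components V : set (set 'rV[L]_n) :=
  [set Z | [/\ Z `<=` V, irreducible Z &
    forall Z', Z' `<=` V -> irreducible Z' -> Z `<=` Z' -> Z' = Z]].

(* T 0, ..., T d is a strictly increasing chain of length d. *)
Definition irreducible_chain Z (T : nat -> set 'rV[L]_n) (d : nat) :=
  (forall i, (i <= d)%N -> closed_in Z (T i) /\ irreducible (T i)) /\
  (forall i, (i < d)%N -> T i `<` T i.+1).

(* Krull dimension of Z in the induced Zariski topology. *)
Definition has_dimension Z (d : nat) :=
  (exists T, irreducible_chain Z T d) /\
  (forall T e, irreducible_chain Z T e -> (e <= d)%N).

End Geometry.

(* A point of affine 3k-space is a row vector of length k * 3, read through
   vec_mx as the k x 3 matrix whose rows are the coordinate blocks.
   Blocks of a point are numbered from 0 by 'I_k: i denotes v_(i+1). *)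
Definition forget_block (L : fieldType) (k : nat) (i : 'I_k)
    (x : 'rV[L]_(k * 3)) : 'rV[L]_(k.-1 * 3) :=
  mxvec (row' i (vec_mx x)).

Definition involves_block (L : fieldType) (k : nat) (i : 'I_k)
    (Z : set 'rV[L]_(k * 3)) : Prop :=
  ~ exists B : set 'rV[L]_(k.-1 * 3),
      Z = \bigcup_(y in B) [set x | forget_block i x = y].

Section Recursion.
Variable R : comNzRingType.
Implicit Types a b : 'rV[R]_3.

Definition cross a b : 'rV[R]_3 :=
  \row_c nth 0 [:: a 0 1 * b 0 2 - a 0 2 * b 0 1;
                   a 0 2 * b 0 0 - a 0 0 * b 0 2;
                   a 0 0 * b 0 1 - a 0 1 * b 0 0] c.

Definition Smx : 'M[R]_3 := diag_mx (\row_c nth 0 [:: -1; -1; 1] c).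

(* v is numbered from 1; only w v j with j >= 2 is meaningful, and it only
   depends on v 1, ..., v j. *)
Fixpoint w (v : nat -> 'rV[R]_3) (j : nat) : 'rV[R]_3 :=
  match j with
  | 0 => 0
  | j'.+1 => if j' == 1%N then cross (v 1%N) (v 2%N)
             else cross (w v j' *m Smx) (v j)
  end.

Definition generated_ideal (m : nat) (g : 'rV[R]_m) : set R :=
  [set p | exists a : 'rV[R]_m, p = \sum_c a 0 c * g 0 c].

End Recursion.

(* The i-th block of variables, with 1 <= i <= k (zero for i > k). *)
Definition var_block (F : fieldType) (k i : nat) : 'rV[{mpoly F[k * 3]}]_3 :=
  \row_c (if insub i.-1 is Some i' then 'X_(mxvec_index (i' : 'I_k) c) else 0).

Definition idealI (F : fieldType) (k : nat) : set {mpoly F[k * 3]} :=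
  generated_ideal (w (@var_block F k) k).
Arguments idealI F k : clear implicits.

Definition vanishing_locus (F L : fieldType) (iota : {rmorphism F -> L})
    (n : nat) (I : set {mpoly F[n]}) : set 'rV[L]_n :=
  zero_locus [set map_mpoly iota p | p in I].

Definition is_algebraic_closure (F : fieldType) (L : closedFieldType)
    (iota : {rmorphism F -> L}) : Prop :=
  forall x : L, algebraicOver iota x.

(* Main.v *)
Require Import Defs.
From mathcomp Require Import all_boot all_order all_algebra.
From mathcomp Require Import boolp classical_sets functions cardinality.
From mathcomp Require Import mpoly.
From mathcomp Require Import ring zify.

(** Put u_1 = v_1 and u_j = S(w_j) for j >= 2, so that w_(j+1) = u_j x v_(j+1)
    for every j >= 1.  If w_k vanishes at a point, let j be the first index at
    which w_j = 0 there.  Then u_(j-1) <> 0 (except when j = 2 and v_1 = 0), so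
    v_j is a multiple of u_(j-1); conversely v_j = t u_(j-1) forces w_j = 0,
    hence w_k = 0.  So the locus is covered by the closures C_j of the sets
    E_j = {v_j in the line of u_(j-1)}, 2 <= j <= k; a point with v_1 = 0 lies
    in C_2 as a limit of points with v_1 = s v_2 (component_cover).

    The set E_j is the image of an affine space of dimension 3k - 2: choose all
    blocks but v_j freely, and the factor t.  Hence C_j is irreducible
    (irreducible_zclosure_range) and the chains of irreducible closed subsets
    of C_j have length at most 3k - 2 (chain_length_le).  A chain of that length
    consists of a flag of coordinate subspaces of {v_j = 0}, followed by C_j
    (coord_flag_chain).

    The upper bound on chains is elementary.  Along T_0 < ... < T_e pick g_i
    that vanishes on T_i but not on T_(i+1).  The monomials in the g_i of
    exponents below D are linearly independent on T_e: a relation, divided by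
    the highest power of g_i that divides it, restricts to a relation on T_i
    (lin_indep_powers).  Pulled back to the N parameters they are D^e
    independent polynomials of degree O(D), and such polynomials span a space
    of dimension O(D^N); for large D this forces e <= N.

    C_j is stable under translating v_i for i > j, because E_j is.  It involves
    v_i for i <= j because w_j = 0 on C_j, while moving v_i alone can turn
    u_(j-1), or v_j if i = j, away from its line (u_varies, cross_neq0).  So the
    C_j are distinct.  Having the same dimension, none contains another
    (has_dimension_inj), and they are the irreducible components. *)

Set Implicit Arguments.
Unset Strict Implicit.
Unset Printing Implicit Defensive.

Import GRing.Theory.
Local Open Scope classical_set_scope.
Local Open Scope card_scope.
Local Open Scope ring_scope.

(** * Zariski-closed and irreducible sets *)
Section ZariskiTopology.
Variables (L : fieldType) (n : nat).
Implicit Types (X Y Z E : set 'rV[L]_n) (p q : {mpoly L[n]}).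

Definition zclosure E : set 'rV[L]_n :=
  zero_locus [set p | forall x, E x -> p.@[x 0] = 0].

Lemma sub_zclosure E : E `<=` zclosure E.
Proof. by move=> x Ex p; apply. Qed.

Lemma zclosure_closed E : zariski_closed (zclosure E).
Proof. by eexists. Qed.

Lemma zclosure_min E A : zariski_closed A -> E `<=` A -> zclosure E `<=` A.
Proof. by move=> [J ->] EA x clx p Jp; apply: clx => y /EA; apply. Qed.

Lemma zclosure_id Z : zariski_closed Z -> zclosure Z = Z.
Proof.
by move=> clZ; apply/seteqP; split; [exact: zclosure_min|exact: sub_zclosure].
Qed.

Lemma zero_locus1_closed p : zariski_closed [set x | p.@[x 0] = 0].
Proof.
exists [set p]; apply/seteqP; split=> x /=; first by move=> px _ ->.
by apply.
Qed.

Lemma zariski_closedI A B :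
  zariski_closed A -> zariski_closed B -> @zariski_closed L n (A `&` B).
Proof.
move=> [J ->] [K ->]; exists (J `|` K); apply/seteqP; split=> x /=.
  by move=> [xJ xK] p [/xJ|/xK].
by move=> xJK; split=> p Jp; apply: xJK; [left|right].
Qed.

Lemma closed_in_sub Z Y : closed_in Z Y -> Y `<=` Z.
Proof. by move=> [A _ ->] x []. Qed.

Lemma closed_in_closed Z Y : zariski_closed Z -> closed_in Z Y ->
  zariski_closed Y.
Proof. by move=> clZ [A clA ->]; exact: zariski_closedI. Qed.

Lemma closed_closed_in Z Y : zariski_closed Y -> Y `<=` Z -> closed_in Z Y.
Proof.
move=> clY YZ; exists Y => //.
by apply/seteqP; split=> x; [move=> Yx; split=> //; exact: YZ|case].
Qed.

Lemma closed_in_separate Z Y z : closed_in Z Y -> Z z -> ~ Y z ->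
  exists2 p, forall x, Y x -> p.@[x 0] = 0 & p.@[z 0] != 0.
Proof.
move=> [A [J ->] ->] Zz /not_andP[//|/existsNP[p /not_implyP[Jp /eqP pz]]].
by exists p => // x [_]; apply.
Qed.

Lemma irreducible_mul Z p q : irreducible Z ->
  (forall x, Z x -> p.@[x 0] * q.@[x 0] = 0) ->
  (forall x, Z x -> p.@[x 0] = 0) \/ (forall x, Z x -> q.@[x 0] = 0).
Proof.
move=> [_ irrZ] pq0.
pose V r := Z `&` [set x | r.@[x 0] = 0].
have clV r : closed_in Z (V r).
  by exists [set x | r.@[x 0] = 0] => //; exact: zero_locus1_closed.
have ZV : Z = V p `|` V q.
  apply/seteqP; split=> x; last by move=> [[]|[]].
  move=> Zx; have /eqP := pq0 x Zx; rewrite mulf_eq0 => /orP[]/eqP H.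
    by left.
  by right.
by have [->|->] := irrZ _ _ (clV p) (clV q) ZV; [left|right]; move=> x [].
Qed.

Lemma zariski_closedU A B :
  zariski_closed A -> zariski_closed B -> @zariski_closed L n (A `|` B).
Proof.
move=> [J ->] [K ->].
exists [set r | exists p q, [/\ J p, K q & r = p * q]].
apply/seteqP; split=> x /=.
  by move=> [xJ|xK] _ [p [q [Jp Kq ->]]];
    rewrite mevalM ?(xJ _ Jp) ?(xK _ Kq) ?mul0r ?mulr0.
move=> xJK; have [xJ|] := pselect (zero_locus J x); first by left.
move=> /existsNP[p /not_implyP[Jp /eqP px]]; right=> q Kq.
have /eqP := xJK (p * q) (ex_intro _ p (ex_intro _ q (And3 Jp Kq erefl))).
by rewrite mevalM mulf_eq0 (negPf px) => /eqP.
Qed.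

Lemma irreducible_subU Z A B : irreducible Z -> zariski_closed A ->
  zariski_closed B -> Z `<=` A `|` B -> Z `<=` A \/ Z `<=` B.
Proof.
move=> [_ irrZ] clA clB ZAB.
have [| | |ZA|ZB] := irrZ (Z `&` A) (Z `&` B).
- by exists A.
- by exists B.
- by rewrite -setIUr; apply/seteqP; split=> x; [move=> Zx; split; auto|case].
- by left; rewrite ZA => x [].
- by right; rewrite ZB => x [].
Qed.

(** This is how an arbitrary irreducible subset of a locus is compared with the
    candidate components, which only cover the locus point by point. *)
Lemma irreducible_sub_cover Z (s : seq nat) (C : nat -> set 'rV[L]_n) :
  irreducible Z -> (forall j, zariski_closed (C j)) ->
  (forall x, Z x -> exists2 j, j \in s & C j x) ->
  exists2 j, j \in s & Z `<=` C j.
Proof.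
move=> irrZ clC; pose U (t : seq nat) := [set x | exists2 j, j \in t & C j x].
have U0 : U [::] = set0 by apply/seteqP; split=> x // [].
have US j t : U (j :: t) = C j `|` U t.
  apply/seteqP; split=> x.
    by move=> [i]; rewrite inE => /orP[/eqP -> |it Ci]; [left|right; exists i].
  by move=> [Cj|[i it Ci]]; [exists j|exists i]; rewrite // inE ?eqxx ?it ?orbT.
have clU t : zariski_closed (U t).
  elim: t => [|j t IH]; last by rewrite US; exact: zariski_closedU.
  rewrite U0; exists [set 1]; apply/seteqP; split=> x //= /(_ 1 erefl).
  by move/eqP; rewrite meval1 oner_eq0.
rewrite -/(Z `<=` U s); elim: s => [|j s IH].
  by rewrite U0; have [[z Zz] _] := irrZ => /(_ z Zz).
rewrite US => /(irreducible_subU irrZ (clC j) (clU s))[ZC|/IH[i si ZC]].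
  by exists j; rewrite ?mem_head.
by exists i; rewrite // inE si orbT.
Qed.

Lemma zariski_closed_coord (P : set 'I_n) :
  @zariski_closed L n [set x | forall m, P m -> x 0 m = 0].
Proof.
exists ((fun m => 'X_m) @` P); apply/seteqP; split=> x /= x0.
  by move=> _ [m Pm <-]; rewrite mevalXU x0.
by move=> m Pm; rewrite -(x0 'X_m) ?mevalXU//; exists m.
Qed.

End ZariskiTopology.

(** * Polynomial maps *)
Section PolynomialMaps.
Variable L : fieldType.

(** Regular functions are treated as functions given by some polynomial, so
    that parametrizations can be written pointwise without ever displaying the
    polynomials behind them. *)
Definition polynomial_fun N (f : 'rV[L]_N -> L) :=
  exists p : {mpoly L[N]}, forall y, f y = p.@[y 0].

Definition polynomial_map N n (Phi : 'rV[L]_N -> 'rV[L]_n) :=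
  forall m, polynomial_fun (fun y => Phi y 0 m).

Lemma polynomial_fun_eq N (f g : 'rV[L]_N -> L) :
  f =1 g -> polynomial_fun f -> polynomial_fun g.
Proof. by move=> fg [p fp]; exists p => y; rewrite -fg fp. Qed.

Lemma polynomial_funC N c : polynomial_fun (fun _ : 'rV[L]_N => c).
Proof. by exists c%:MP => y; rewrite mevalC. Qed.

Lemma polynomial_fun_coord N m : polynomial_fun (fun y : 'rV[L]_N => y 0 m).
Proof. by exists 'X_m => y; rewrite mevalXU. Qed.

Lemma polynomial_funD N (f g : 'rV[L]_N -> L) :
  polynomial_fun f -> polynomial_fun g -> polynomial_fun (fun y => f y + g y).
Proof. by move=> [p fp] [q gq]; exists (p + q) => y; rewrite mevalD fp gq. Qed.

Lemma polynomial_funB N (f g : 'rV[L]_N -> L) :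
  polynomial_fun f -> polynomial_fun g -> polynomial_fun (fun y => f y - g y).
Proof. by move=> [p fp] [q gq]; exists (p - q) => y; rewrite mevalB fp gq. Qed.

Lemma polynomial_funM N (f g : 'rV[L]_N -> L) :
  polynomial_fun f -> polynomial_fun g -> polynomial_fun (fun y => f y * g y).
Proof. by move=> [p fp] [q gq]; exists (p * q) => y; rewrite mevalM fp gq. Qed.

Lemma polynomial_fun_comp N n (Phi : 'rV[L]_N -> 'rV[L]_n) (p : {mpoly L[n]}) :
  polynomial_map Phi -> polynomial_fun (fun y => p.@[Phi y 0]).
Proof.
move=> /choice[P PhiP]; exists (p \mPo [tuple P i | i < n]) => y.
by rewrite comp_mpoly_meval; apply: meval_eq => i; rewrite tnth_mktuple PhiP.
Qed.

(** Restriction to a line reduces questions about several variables to the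
    finiteness of the roots of a univariate polynomial. *)
Lemma meval_line N (p : {mpoly L[N]}) (a b : 'rV[L]_N) :
  exists r : {poly L}, forall s, r.[s] = p.@[(a + s *: b) 0].
Proof.
exists (mmap polyC (fun i => (a 0 i)%:P + b 0 i *: 'X) p) => s.
rewrite mevalE /mmap horner_sum; apply: eq_bigr => m _.
rewrite hornerM hornerC /mmap1 horner_prod; congr (_ * _).
apply: eq_bigr => i _; rewrite horner_exp hornerD hornerC hornerZ hornerX.
by rewrite !mxE mulrC.
Qed.

End PolynomialMaps.

(** * Closures of images of affine spaces are irreducible *)
Section ClosureOfImage.
Variable L : closedFieldType.

(** On the line through y and z the two restrictions are nonzero univariate
    polynomials, and so is their product; over an algebraically closed, hence
    infinite, field the product has a non-root. *)
Lemma common_nonzero N (p q : {mpoly L[N]}) (y z : 'rV[L]_N) :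
  p.@[y 0] != 0 -> q.@[z 0] != 0 ->
  exists x : 'rV[L]_N, p.@[x 0] != 0 /\ q.@[x 0] != 0.
Proof.
move=> py qz.
have [r rE] := meval_line p y (z - y); have [s sE] := meval_line q y (z - y).
have r0 : r != 0.
  apply: contraNneq py => r0.
  by rewrite -[y]addr0 -(scale0r (z - y)) -rE r0 horner0.
have s0 : s != 0.
  apply: contraNneq qz => s0.
  by rewrite -[z](subrKC y) -[z - y]scale1r -sE s0 horner0.
have /closed_nonrootP[t] : r * s != 0 by rewrite mulf_neq0.
rewrite /root hornerM mulf_eq0 negb_or rE sE => /andP[pt qt].
by exists (y + t *: (z - y)).
Qed.

(** Two proper closed subsets miss points of the image, say Phi y and Phi z, as
    witnessed by two polynomials; by common_nonzero some Phi x escapes both. *)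
Lemma irreducible_zclosure_range N n (Phi : 'rV[L]_N -> 'rV[L]_n) :
  polynomial_map Phi -> irreducible (zclosure (range Phi)).
Proof.
move=> PhiP.
split; first by exists (Phi 0); apply: sub_zclosure; exists 0.
set Z := zclosure _ => A B clA clB ZAB; apply: contrapT => /not_orP[ZA ZB].
have key Y : closed_in Z Y -> Z <> Y ->
    exists p (q : {mpoly L[N]}) (y : 'rV[L]_N),
      [/\ forall x, Y x -> p.@[x 0] = 0,
          forall y, p.@[Phi y 0] = q.@[y 0] & q.@[y 0] != 0].
  move=> clY ZY.
  have [z /not_implyP[Zz Yz]] : exists z, ~ (Z z -> Y z).
    apply/existsNP => ZsubY; apply: ZY; apply/seteqP; split=> //.
    exact: closed_in_sub.
  have [p pY pz] := closed_in_separate clY Zz Yz.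
  have [q pq] := polynomial_fun_comp p PhiP.
  have [y qy] : exists y : 'rV[L]_N, q.@[y 0] <> 0.
    apply/existsNP => q0; move/eqP: pz; apply; apply: Zz => _ [y _ <-].
    by rewrite pq q0.
  by exists p, q, y; split=> //; exact/eqP.
have [p [q [y [pA pq qy]]]] := key A clA ZA.
have [p' [q' [z [pB pq' qz]]]] := key B clB ZB.
have [x [/eqP qx /eqP q'x]] := common_nonzero qy qz.
have : Z (Phi x) by apply: sub_zclosure; exists x.
by rewrite ZAB => -[/pA|/pB]; rewrite ?pq ?pq'.
Qed.

End ClosureOfImage.

(** * Upper bound on the length of chains *)
Section DimensionBound.
Variable L : fieldType.

Definition lin_indep_on n (T : set 'rV[L]_n) (I : finType)
    (b : I -> {mpoly L[n]}) :=
  forall c : I -> L, (forall x, T x -> \sum_a c a * (b a).@[x 0] = 0) ->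
  forall a, c a = 0.

(** In a relation on T', let i be the lowest power of g that occurs.  As T' is
    irreducible and g is nonzero on it, the relation may be divided by g ^+ i;
    restricted to T, where g = 0, only the terms of exponent i survive, and
    they form a relation between the b a.  So no power occurs at all. *)
Lemma lin_indep_powers n (T T' : set 'rV[L]_n) (g : {mpoly L[n]}) (I : finType)
    (b : I -> {mpoly L[n]}) (D : nat) :
  irreducible T' -> T `<=` T' -> (forall x, T x -> g.@[x 0] = 0) ->
  ~ (forall x, T' x -> g.@[x 0] = 0) -> lin_indep_on T b ->
  lin_indep_on T' (fun ai : I * 'I_D => b ai.1 * g ^+ ai.2).
Proof.
move=> irr TT' gT gT' indT c cT'.
suff c0 i (ltiD : (i < D)%N) a : c (a, Ordinal ltiD) = 0.
  by move=> [a [i ltiD]]; exact: c0.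
elim/ltn_ind: i ltiD a => i IH ltiD.
(* H is what remains of the relation c after division by g ^+ i. *)
pose H := \sum_a \sum_(j < D | (i <= j)%N) c (a, j) *: (b a * g ^+ (j - i)).
have HE x : H.@[x 0] = \sum_a \sum_(j < D | (i <= j)%N)
    c (a, j) * ((b a).@[x 0] * g.@[x 0] ^+ (j - i)).
  rewrite raddf_sum; apply: eq_bigr => a _.
  rewrite raddf_sum; apply: eq_bigr => j _.
  by rewrite /= mevalZ mevalM rmorphXn.
have gH0 x : T' x -> (g ^+ i).@[x 0] * H.@[x 0] = 0.
  move=> /cT' <-; rewrite HE mulr_sumr.
  transitivity (\sum_a \sum_(j < D) c (a, j) * (b a * g ^+ j).@[x 0]).
    apply: eq_bigr => a _; rewrite mulr_sumr big_mkcond /=.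
    apply: eq_bigr => j _.
    rewrite mevalM !rmorphXn /=; case: leqP => [leij|ltji].
      by rewrite -{2}(subnK leij) exprD; ring.
    by case: j ltji => j ltj /= ltji; rewrite (IH j ltji) mul0r.
  by rewrite pair_big; apply: eq_bigr => -[].
have H0 x : T' x -> H.@[x 0] = 0.
  have [gi0|] := irreducible_mul irr gH0; last exact.
  case: gT' => y /gi0 /eqP; rewrite rmorphXn expf_eq0 => /andP[_ /eqP//].
move=> a; apply: (indT (fun a => c (a, Ordinal ltiD))) => x Tx.
rewrite -[RHS](H0 x (TT' _ Tx)) HE; apply: eq_bigr => {}a _.
rewrite (bigD1 (Ordinal ltiD)) //= subnn mulr1 big1 ?addr0 // => j.
case/andP => leij neji; rewrite gT // expr0n.
by rewrite subn_eq0 leqNgt ltn_neqAle leij andbT eq_sym neji !mulr0.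
Qed.

Lemma msizeM_le_add N (p q : {mpoly L[N]}) d e :
  (msize p <= d.+1)%N -> (msize q <= e.+1)%N -> (msize (p * q) <= (d + e).+1)%N.
Proof.
have [->|p0] := eqVneq p 0; first by rewrite mul0r msize0.
have [->|q0] := eqVneq q 0; first by rewrite mulr0 msize0.
rewrite msizeM // => pd qe.
by rewrite -subn1 leq_subLR (leq_trans (leq_add pd qe)) // addSn addnS.
Qed.

Lemma msizeX_le_mul N (p : {mpoly L[N]}) d j :
  (msize p <= d.+1)%N -> (msize (p ^+ j) <= (j * d).+1)%N.
Proof.
move=> pd; elim: j => [|j IH]; first by rewrite expr0 msize1.
by rewrite exprS mulSn; exact: msizeM_le_add.
Qed.

(** A monomial of degree less than M has all its exponents less than M, so at
    most M ^ N monomials occur in the B a. *)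
Lemma lin_dep_of_msize N (I : finType) (B : I -> {mpoly L[N]}) M :
  (forall a, (msize (B a) <= M)%N) -> (M ^ N < #|I|)%N ->
  exists2 c : I -> L, \sum_a c a *: B a = 0 & exists a, c a != 0.
Proof.
move=> BM ltMI.
pose mon (f : {ffun 'I_N -> 'I_M}) : 'X_{1..N} :=
  [multinom (f i : nat) | i < N].
pose A := \matrix_(i < #|I|, j < #|{ffun 'I_N -> 'I_M}|)
  (B (enum_val i))@_(mon (enum_val j)).
have : kermx A != 0.
  rewrite -mxrank_eq0 mxrank_ker subn_eq0 -ltnNge.
  by rewrite (leq_ltn_trans (rank_leq_col A)) // card_ffun !card_ord.
move=> /rowV0Pn[v /sub_kermxP vA v0].
exists (fun a => v 0 (enum_rank a)); last first.
  have [j vj] := rV0Pn _ v0.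
  by exists (enum_val j); rewrite enum_valK.
apply/mpolyP => m; rewrite mcoeff0 raddf_sum /=.
have [ltmM|leMm] := ltnP (mdeg m) M; last first.
  apply: big1 => a _.
  rewrite mcoeffZ (memN_msupp_eq0 (msize_mdeg_ge _)) ?mulr0//.
  exact: leq_trans leMm.
have mM i : (m i < M)%N.
  by rewrite (leq_ltn_trans _ ltmM) // mdegE (bigD1 i) //= leq_addr.
pose f := [ffun i => Ordinal (mM i)].
have monf : mon f = m by apply/mnmP => i; rewrite mnmE ffunE.
have := congr1 (fun u : 'rV_ _ => u 0 (enum_rank f)) vA; rewrite !mxE => vAf.
rewrite -[RHS]vAf (reindex enum_rank); last exact: onW_bij (enum_rank_bij _).
by apply: eq_bigr => a _; rewrite mcoeffZ !mxE !enum_rankK monf.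
Qed.

(** The family consists of the monomials in g 0, ..., g e.-1 with exponents
    below D; the B a are their pullbacks along Phi. *)
Lemma lin_indep_family N n (Phi : 'rV[L]_N -> 'rV[L]_n)
    (T : nat -> set 'rV[L]_n) (g : nat -> {mpoly L[n]}) (G : nat -> {mpoly L[N]}) (e d D : nat) :
  T 0%N !=set0 ->
  (forall i, (i < e)%N -> [/\ irreducible (T i.+1), T i `<=` T i.+1,
     forall x, T i x -> (g i).@[x 0] = 0 &
     ~ (forall x, T i.+1 x -> (g i).@[x 0] = 0)]) ->
  (forall i y, (g i).@[Phi y 0] = (G i).@[y 0]) ->
  (forall i, (i < e)%N -> (msize (G i) <= d.+1)%N) ->
  exists (I : finType) (b : I -> {mpoly L[n]}) (B : I -> {mpoly L[N]}),
    [/\ #|I| = (D ^ e)%N, lin_indep_on (T e) b,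
        forall a y, (b a).@[Phi y 0] = (B a).@[y 0] &
        forall a, (msize (B a) <= (e * D * d).+1)%N].
Proof.
move=> [x0 Tx0] gT gG; elim: e gT => [|e IH] gT Gd.
  exists unit, (fun _ => 1), (fun _ => 1); split; rewrite ?card_unit //.
  - move=> c c0 []; rewrite -(c0 _ Tx0) (bigD1 tt) //= big1 => [|[]//].
    by rewrite meval1 mulr1 addr0.
  - by move=> _ y; rewrite !meval1.
  - by move=> _; rewrite msize1.
have [i ltie|i ltie|I [b [B [cardI indb bB Bd]]]] := IH.
- exact: (gT i (leqW ltie)).
- exact: (Gd i (leqW ltie)).
have [irr TT gTe gTe1] := gT e (leqnn _).
exists (I * 'I_D)%type, (fun ai : I * 'I_D => b ai.1 * g e ^+ ai.2),
  (fun ai : I * 'I_D => B ai.1 * G e ^+ ai.2); split.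
- by rewrite card_prod cardI card_ord expnSr.
- exact: lin_indep_powers gTe gTe1 indb.
- by move=> a y; rewrite !mevalM !rmorphXn /= bB gG.
- move=> [a j] /=.
  have := msizeM_le_add (Bd a) (msizeX_le_mul j (Gd e (leqnn _))).
  move/leq_trans; apply; rewrite ltnS !mulSn mulnDl addnC leq_add2r.
  by rewrite leq_mul2r ltnW ?orbT.
Qed.

(** If N < e, the D ^ e monomials in the separating polynomials pull back to
    polynomials of degree at most e * D * d in N variables.  Taking D larger
    than (e * d).+1 ^ N, there are too many of them to be independent. *)
Lemma chain_length_le N n (Phi : 'rV[L]_N -> 'rV[L]_n) T e :
  polynomial_map Phi -> irreducible_chain (zclosure (range Phi)) T e ->
  (e <= N)%N.
Proof.
move=> PhiP [Tcl Tlt]; rewrite leqNgt; apply/negP => ltNe.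
have /choice[g gT] i : exists p : {mpoly L[n]}, (i < e)%N ->
    (forall x, T i x -> p.@[x 0] = 0) /\
    ~ (forall x, T i.+1 x -> p.@[x 0] = 0).
  have [ltie|_] := boolP (i < e)%N; last by exists 0.
  have [_ /existsNP[z /not_implyP[Tz nTz]]] := Tlt i ltie.
  have [clT _] := Tcl i (ltnW ltie); have [clT1 _] := Tcl i.+1 ltie.
  have [p pT pz] := closed_in_separate clT (closed_in_sub clT1 Tz) nTz.
  exists p => _; split=> // p0; by rewrite p0 ?eqxx in pz.
have /choice[G gG] i := polynomial_fun_comp (g i) PhiP.
pose d := \max_(i < e) msize (G i).
pose D := ((e * d).+1 ^ N).+1.
have [|i ltie|i ltie|I [b [B [cardI indb bB Bd]]]] :=
    @lin_indep_family N n Phi T g G e d D _ _ gG.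
- by have [_ []] := Tcl 0%N isT.
- have [_ irr] := Tcl i.+1 ltie; have [TT _] := Tlt i ltie.
  by have [] := gT i ltie; split.
- rewrite leqW //; exact: (leq_bigmax (Ordinal ltie)).
have [|c cB [a /eqP ca]] := lin_dep_of_msize Bd.
  rewrite cardI; apply: (@leq_trans (D ^ N.+1)); last by rewrite leq_pexp2l.
  apply: (@leq_ltn_trans ((D * (e * d).+1) ^ N)).
    have [->//|N0] := posnP N; rewrite leq_exp2r // mulnS mulnCA mulnA.
    by rewrite -add1n leq_add2r.
  by rewrite expnMn expnS mulnC ltn_pmul2r ?expn_gt0.
apply: ca; apply: indb => x Tx.
have [clT _] := Tcl e (leqnn e).
have := closed_in_sub clT Tx (\sum_a c a *: b a).
rewrite raddf_sum => /= sum0; rewrite -[RHS]sum0 => [|_ [y _ <-]].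
  by apply: eq_bigr => i _; rewrite mevalZ.
rewrite -(meval0 (y 0)) -cB !raddf_sum.
by apply: eq_bigr => i _; rewrite /= !mevalZ bB.
Qed.

End DimensionBound.

(** * Chains of maximal length *)
Section Dimension.
Variables (L : closedFieldType) (n : nat).

(** A coordinate subspace is the image of the projection that kills the
    coordinates in P. *)
Lemma irreducible_coord_subspace (P : pred 'I_n) :
  irreducible [set x : 'rV[L]_n | forall m, P m -> x 0 m = 0].
Proof.
set A := [set x | _].
pose proj (y : 'rV[L]_n) : 'rV[L]_n := \row_m (if P m then 0 else y 0 m).
suff -> : A = zclosure (range proj).
  apply: irreducible_zclosure_range => m.
  have [Pm|nPm] := boolP (P m).
    by apply: polynomial_fun_eq (polynomial_funC _ 0) => y; rewrite mxE Pm.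
  apply: polynomial_fun_eq (polynomial_fun_coord L m) => y.
  by rewrite mxE (negPf nPm).
rewrite (_ : range proj = A) ?zclosure_id //.
  exact: (@zariski_closed_coord L n (fun m => P m)).
apply/seteqP; split=> [_ [y _ <-] m Pm|x Ax]; first by rewrite mxE Pm.
by exists x => //; apply/rowP => m; rewrite mxE; case: ifP => // /Ax.
Qed.

(** The flag frees the coordinates listed in s one at a time; Z itself is added
    on top of the last coordinate subspace. *)
Lemma coord_flag_chain (s : seq 'I_n) (Z : set 'rV[L]_n) :
  uniq s -> zariski_closed Z -> irreducible Z ->
  [set x : 'rV[L]_n | forall m, m \notin s -> x 0 m = 0] `<` Z ->
  exists T, irreducible_chain Z T (size s).+1.
Proof.
move=> uniq_s clZ irrZ [sZ Zs].
pose A d := [set x : 'rV[L]_n | forall m, m \notin take d s -> x 0 m = 0].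
have AZ d : A d `<=` Z.
  move=> x Ax; apply: sZ => m nsm; apply: Ax.
  by apply: contra nsm; exact: mem_take.
exists (fun d => if (d <= size s)%N then A d else Z); split=> d.
  case: ifP => _ _; last by split=> //; exact: closed_closed_in.
  split; last exact: irreducible_coord_subspace.
  apply: closed_closed_in (AZ d).
  exact: (@zariski_closed_coord L n (fun m => m \notin take d s)).
rewrite ltnS => leds; rewrite leds.
have [ltds|lesd] := ltnP d (size s); last first.
  by split=> [|ZA]; [exact: AZ | apply: Zs => x /ZA; rewrite /A take_oversize].
have m0 : 'I_n by case: (s) ltds => // m.
split=> [x Ax m|/(_ (delta_mx 0 (nth m0 s d)))].
  by rewrite (take_nth m0) // mem_rcons inE negb_or => /andP[_]; exact: Ax.
move=> A1; suff /A1/(_ (nth m0 s d)) : A d.+1 (delta_mx 0 (nth m0 s d)).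
  rewrite in_take ?mem_nth // index_uniq // ltnn => /(_ isT)/eqP.
  by rewrite mxE !eqxx oner_eq0.
move=> m; rewrite (take_nth m0) // mem_rcons inE negb_or => /andP[/negPf neq _].
by rewrite mxE neq andbF.
Qed.

(** Otherwise Z' could be put on top of a maximal chain of Z. *)
Lemma has_dimension_inj (Z Z' : set 'rV[L]_n) d :
  zariski_closed Z -> zariski_closed Z' -> irreducible Z' ->
  has_dimension Z d -> has_dimension Z' d -> Z `<=` Z' -> Z = Z'.
Proof.
move=> clZ clZ' irrZ' [[T [Tcl Tlt]] _] [_ le_d] ZZ'.
apply/seteqP; split=> //; apply: contrapT => nZ'Z.
have TZ i : (i <= d)%N -> T i `<=` Z by case/Tcl => /closed_in_sub.
suff /le_d : irreducible_chain Z' (fun i => if (i <= d)%N then T i else Z') d.+1.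
  by rewrite ltnn.
split=> i.
  case: ifP => [led|] _; last by split=> //; exact: closed_closed_in.
  have [clT irrT] := Tcl i led; split=> //.
  apply: closed_closed_in (closed_in_closed clZ clT) _.
  by apply: subset_trans ZZ'; exact: TZ.
rewrite ltnS => led; rewrite led; case: ifP => [|_]; first exact: Tlt.
split=> [|Z'T]; first exact: subset_trans (TZ _ led) ZZ'.
by apply: nZ'Z; exact: subset_trans Z'T (TZ _ led).
Qed.

End Dimension.

(** * The cross product *)
Section CrossProduct.
Variable K : fieldType.
Implicit Types a b : 'rV[K]_3.

Lemma row3P a b : a 0 0 = b 0 0 -> a 0 1 = b 0 1 -> a 0 2 = b 0 2 -> a = b.
Proof.
move=> e0 e1 e2; apply/rowP => -[[|[|[|//]]] lt3].
- by rewrite (_ : Ordinal lt3 = 0) //; exact: val_inj.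
- by rewrite (_ : Ordinal lt3 = 1) //; exact: val_inj.
- by rewrite (_ : Ordinal lt3 = 2) //; exact: val_inj.
Qed.

Lemma crossE a b :
  [/\ cross a b 0 0 = a 0 1 * b 0 2 - a 0 2 * b 0 1,
      cross a b 0 1 = a 0 2 * b 0 0 - a 0 0 * b 0 2 &
      cross a b 0 2 = a 0 0 * b 0 1 - a 0 1 * b 0 0].
Proof. by split; rewrite mxE. Qed.

Lemma mulSmxE a : [/\ (a *m Smx K) 0 0 = - a 0 0, (a *m Smx K) 0 1 = - a 0 1 &
  (a *m Smx K) 0 2 = a 0 2].
Proof. by split; rewrite mul_mx_diag !mxE /= ?mulrN1 ?mulr1. Qed.

(** S is a rotation. *)
Lemma cross_mulSmx a b : cross (a *m Smx K) (b *m Smx K) = cross a b *m Smx K.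
Proof.
have [a0 a1 a2] := mulSmxE a; have [b0 b1 b2] := mulSmxE b.
have [c0 c1 c2] := crossE a b.
have [d0 d1 d2] := crossE (a *m Smx K) (b *m Smx K).
have [e0 e1 e2] := mulSmxE (cross a b).
by apply: row3P; rewrite ?d0 ?d1 ?d2 ?e0 ?e1 ?e2 ?a0 ?a1 ?a2 ?b0 ?b1 ?b2;
  rewrite ?c0 ?c1 ?c2; ring.
Qed.

Lemma mulSmxK a : a *m Smx K *m Smx K = a.
Proof.
have [a0 a1 a2] := mulSmxE a; have [b0 b1 b2] := mulSmxE (a *m Smx K).
by apply: row3P; rewrite ?b0 ?b1 ?b2 ?a0 ?a1 ?a2 ?opprK.
Qed.

Lemma mulSmx_eq0 a : (a *m Smx K == 0) = (a == 0).
Proof.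
apply/eqP/eqP => [a0|->]; last by rewrite mul0mx.
by rewrite -[a]mulSmxK a0 mul0mx.
Qed.

Lemma cross0l b : cross 0 b = 0.
Proof.
have [c0 c1 c2] := crossE 0 b.
by apply: row3P; rewrite ?c0 ?c1 ?c2 !mxE; ring.
Qed.

Lemma cross_anticomm a b : cross a b = - cross b a.
Proof.
have [c0 c1 c2] := crossE a b; have [d0 d1 d2] := crossE b a.
by apply: row3P; rewrite [RHS]mxE ?c0 ?c1 ?c2 ?d0 ?d1 ?d2; ring.
Qed.

Lemma cross_scale a t : cross a (t *: a) = 0.
Proof.
have [c0 c1 c2] := crossE a (t *: a).
by apply: row3P; rewrite ?c0 ?c1 ?c2 !mxE; ring.
Qed.

Lemma row3_neq0 a : a != 0 -> [\/ a 0 0 != 0, a 0 1 != 0 | a 0 2 != 0].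
Proof.
move=> a0; have [e0|] := eqVneq (a 0 0) 0; last by constructor 1.
have [e1|] := eqVneq (a 0 1) 0; last by constructor 2.
constructor 3; apply: contraNneq a0 => e2; apply/eqP.
by apply: row3P; rewrite mxE.
Qed.

Lemma cross_eq0 a b : a != 0 -> cross a b = 0 -> exists t, b = t *: a.
Proof.
have [c0 c1 c2] := crossE a b => /row3_neq0 a0 c.
move: c0 c1 c2; rewrite c !mxE.
move=> /esym/eqP; rewrite subr_eq0 => /eqP c0.
move=> /esym/eqP; rewrite subr_eq0 => /eqP c1.
move=> /esym/eqP; rewrite subr_eq0 => /eqP c2.
case: a0 => nz.
- exists (b 0 0 / a 0 0); apply: row3P; rewrite mxE; apply: (mulfI nz).
  + by field.
  + by rewrite c2; field.
  + by rewrite -c1; field.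
- exists (b 0 1 / a 0 1); apply: row3P; rewrite mxE; apply: (mulfI nz).
  + by rewrite -c2; field.
  + by field.
  + by rewrite c0; field.
- exists (b 0 2 / a 0 2); apply: row3P; rewrite mxE; apply: (mulfI nz).
  + by rewrite c1; field.
  + by rewrite -c0; field.
  + by field.
Qed.

(** The scalar triple product, that is, the determinant of the rows a, b, c. *)
Definition det3 a b c := \sum_i a 0 i * cross b c 0 i.

Lemma det3E a b c : det3 a b c = a 0 0 * (b 0 1 * c 0 2 - b 0 2 * c 0 1) +
  a 0 1 * (b 0 2 * c 0 0 - b 0 0 * c 0 2) +
  a 0 2 * (b 0 0 * c 0 1 - b 0 1 * c 0 0).
Proof.
have [c0 c1 c2] := crossE b c.
rewrite /det3 !big_ord_recl big_ord0 addr0 addrA.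
have -> : lift ord0 (lift ord0 ord0) = 2 :> 'I_3 by exact: val_inj.
have -> : lift ord0 ord0 = 1 :> 'I_3 by exact: val_inj.
by rewrite c0 c1 c2.
Qed.

Lemma cross_cross_l a b c : cross (cross a b) (cross a c) = det3 a b c *: a.
Proof.
have [b0 b1 b2] := crossE a b; have [c0 c1 c2] := crossE a c.
have [d0 d1 d2] := crossE (cross a b) (cross a c).
by apply: row3P; rewrite [RHS]mxE ?d0 ?d1 ?d2 ?b0 ?b1 ?b2 ?c0 ?c1 ?c2 det3E;
  ring.
Qed.

Lemma cross_cross_r a b c : cross (cross a c) (cross b c) = det3 c a b *: c.
Proof.
have [b0 b1 b2] := crossE b c; have [c0 c1 c2] := crossE a c.
have [d0 d1 d2] := crossE (cross a c) (cross b c).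
by apply: row3P; rewrite [RHS]mxE ?d0 ?d1 ?d2 ?b0 ?b1 ?b2 ?c0 ?c1 ?c2 det3E;
  ring.
Qed.

Lemma det3_neq0 a : a != 0 -> exists b c, det3 a b c != 0.
Proof.
move=> /row3_neq0[] nz;
  [exists (delta_mx 0 1), (delta_mx 0 2) |
   exists (delta_mx 0 2), (delta_mx 0 0) |
   exists (delta_mx 0 0), (delta_mx 0 1)];
  by apply: contraNneq nz; rewrite det3E !mxE /= => <-; apply/eqP; ring.
Qed.

Lemma cross_independent_l a : a != 0 ->
  exists b c, cross (cross a b) (cross a c) != 0.
Proof.
move=> a0; have [b [c nz]] := det3_neq0 a0; exists b, c.
by rewrite cross_cross_l scaler_eq0 negb_or nz.
Qed.

Lemma cross_neq0 a : a != 0 -> exists b, cross a b != 0.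
Proof.
move=> /cross_independent_l[b [c]]; exists b.
by apply: contraNneq p => ->; rewrite cross0l.
Qed.

(** (a x c) x (b x c) is det(c, a, b) times c, so c only has to be chosen
    outside the plane of a and b.  Since a x b may be isotropic, c is taken to
    be a basis vector rather than a x b. *)
Lemma cross_independent_r a b : cross a b != 0 ->
  exists c, cross (cross a c) (cross b c) != 0.
Proof.
move=> ab0.
have [m abm] : exists m, cross a b 0 m != 0.
  by apply/rV0Pn.
exists (delta_mx 0 m); rewrite cross_cross_r scaler_eq0 negb_or.
apply/andP; split.
  rewrite /det3 (bigD1 m) //= mxE !eqxx mul1r big1 ?addr0 // => i /negPf nim.
  by rewrite mxE nim mul0r.
by apply/rV0Pn; exists m; rewrite mxE !eqxx oner_eq0.
Qed.

End CrossProduct.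

(** * The recursion *)
Section Words.
Variable K : fieldType.
Implicit Types v : nat -> 'rV[K]_3.

(** The vector crossed with v_(j+1) to give w_(j+1); taking u_1 = v_1 makes the
    recursion uniform from j = 1 on (see wS). *)
Definition u v j : 'rV[K]_3 := if j == 1%N then v 1%N else w v j *m Smx K.

Lemma wS v j : (0 < j)%N -> w v j.+1 = cross (u v j) (v j.+1).
Proof. by case: j => [|[|j]]. Qed.

Lemma uS v j : (0 < j)%N -> u v j.+1 = cross (u v j) (v j.+1) *m Smx K.
Proof. by move=> j0; rewrite -wS //; case: j j0. Qed.

Lemma u_eq0 v j : (1 < j)%N -> (u v j == 0) = (w v j == 0).
Proof. by move=> j1; rewrite /u gtn_eqF // mulSmx_eq0. Qed.

Lemma u_ext v v' j : (0 < j)%N ->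
  (forall i, (0 < i <= j)%N -> v i = v' i) -> u v j = u v' j.
Proof.
elim: j => // -[_ _|j IH _] vv'; first by rewrite /u vv'.
rewrite !(@uS _ j.+1) // IH ?vv' ?leqnn // => i /andP[i0 ij].
by rewrite vv' // i0 leqW.
Qed.

Lemma w_eq0_leq v j k : (1 < j <= k)%N -> w v j = 0 -> w v k = 0.
Proof.
move=> /andP[j1 jk] wj; elim: k jk => [|k IH].
  by rewrite leqn0; case: j j1 {wj}.
rewrite leq_eqVlt => /orP[/eqP <- //|]; rewrite ltnS => jk.
have k1 : (1 < k)%N := leq_trans j1 jk.
have /eqP := IH jk; rewrite -u_eq0 // wS 1?ltnW // => /eqP ->.
by rewrite cross0l.
Qed.

Definition update v i a := fun l : nat => if l == i then a else v l.

Lemma u_update v i a j : (0 < j < i)%N -> u (update v i a) j = u v j.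
Proof.
move=> /andP[j0 ji]; apply: u_ext => // l /andP[_ lj].
by rewrite /update ltn_eqF // (leq_ltn_trans lj).
Qed.

Lemma u_neq0 j : (0 < j)%N -> exists v, u v j != 0.
Proof.
elim: j => // -[_ _|j IH _].
  by exists (fun _ => delta_mx 0 0); apply/rV0Pn; exists 0; rewrite mxE oner_eq0.
have [//|v nz] := IH; have [b nzb] := cross_neq0 nz.
exists (update v j.+2 b); rewrite (@uS _ j.+1) // mulSmx_eq0 u_update ?leqnn //.
by rewrite /update eqxx.
Qed.

(** Block i alone can turn u_j off its line.  At j = i this holds because
    u_i = S(u_(i-1) x v_i) with u_(i-1) nonzero; the next block can then always
    be chosen so that two independent vectors stay independent after being
    crossed with it. *)
Lemma u_varies i j : (0 < i <= j)%N ->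
  exists v a, cross (u v j) (u (update v i a) j) != 0.
Proof.
move=> /andP[i0]; elim: j => [|j IH]; first by rewrite leqn0; case: i i0.
rewrite leq_eqVlt => /orP[/eqP ij|].
  rewrite -{j IH}ij; case: i i0 => // -[_|i _].
    have [//|v nz] := @u_neq0 1; have [a nza] := cross_neq0 nz.
    by exists v, a.
  have [//|v nz] := @u_neq0 i.+1.
  have [b [c nzbc]] := cross_independent_l nz.
  exists (update v i.+2 b), c.
  rewrite !(@uS _ i.+1) // !u_update ?leqnn // /update !eqxx.
  by rewrite cross_mulSmx mulSmx_eq0.
rewrite ltnS => ij; have [v [a nz]] := IH ij.
have [c nzc] := cross_independent_r nz.
have j0 : (0 < j)%N := leq_trans i0 ij.
have ne_ij : (j.+1 == i) = false by rewrite gtn_eqF.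
exists (update v j.+1 c), a; rewrite !(@uS _ j) // cross_mulSmx mulSmx_eq0.
rewrite u_update ?j0 ?leqnn //.
have -> : u (update (update v j.+1 c) i a) j = u (update v i a) j.
  apply: u_ext => // l /andP[_ lj].
  by rewrite /update (ltn_eqF (lj : (l < j.+1)%N)).
by rewrite /update ne_ij eqxx.
Qed.

(** The index found is the first one at which w vanishes. *)
Lemma w_eq0_split v k : (1 < k)%N -> w v k = 0 ->
  exists2 j, (1 < j <= k)%N &
    (exists t, v j = t *: u v j.-1) \/ j = 2 /\ v 1%N = 0.
Proof.
elim: k => // -[//|[_ _|k IH _]] wk.
  exists 2 => //; have [v1|v1] := eqVneq (v 1%N) 0; first by right.
  by left; exact: cross_eq0.
have [uk|uk] := eqVneq (u v k.+2) 0.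
  have [//||j /andP[j1 jk] H] := IH.
    by apply/eqP; rewrite -u_eq0 // uk.
  by exists j; rewrite // j1 leqW.
exists k.+3; first by rewrite leqnn.
by left; apply: cross_eq0 => //; rewrite -wS.
Qed.

End Words.

Lemma w_map (R R' : comNzRingType) (f : {rmorphism R -> R'}) v j :
  map_mx f (w v j) = w (fun i => map_mx f (v i)) j.
Proof.
have map_cross a b : map_mx f (cross a b) = cross (map_mx f a) (map_mx f b).
  have [a0 a1 a2] : [/\ map_mx f a 0 0 = f (a 0 0), map_mx f a 0 1 = f (a 0 1) &
    map_mx f a 0 2 = f (a 0 2)] by split; rewrite mxE.
  apply/rowP => -[[|[|[|//]]] lt3]; rewrite !mxE /= rmorphB !rmorphM //.
have mapS a : map_mx f (a *m Smx R) = map_mx f a *m Smx R'.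
  rewrite map_mxM; congr (_ *m _); rewrite /Smx map_diag_mx; congr diag_mx.
  by apply/rowP => -[[|[|[|//]]] lt3]; rewrite !mxE /= ?rmorphN1 ?rmorph1.
elim: j => [|j IH] /=; first by rewrite map_mx0.
by case: ifP => _; rewrite map_cross // mapS IH.
Qed.

(** * Polynomial families of vectors *)
Section PolynomialVectors.
Variables (L : fieldType) (N : nat).

Lemma polynomial_mapC n (a : 'rV[L]_n) :
  polynomial_map (fun _ : 'rV[L]_N => a).
Proof. by move=> m; exact: polynomial_funC. Qed.

Lemma polynomial_mapZ n (t : 'rV[L]_N -> L) (f : 'rV[L]_N -> 'rV[L]_n) :
  polynomial_fun t -> polynomial_map f -> polynomial_map (fun y => t y *: f y).
Proof.
move=> tp fp m; apply: polynomial_fun_eq (polynomial_funM tp (fp m)) => y.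
by rewrite mxE.
Qed.

Lemma polynomial_map_cross (f g : 'rV[L]_N -> 'rV[L]_3) :
  polynomial_map f -> polynomial_map g ->
  polynomial_map (fun y => cross (f y) (g y)).
Proof.
move=> fp gp -[[|[|[|//]]] lt3];
  by apply: polynomial_fun_eq (polynomial_funB (polynomial_funM (fp _) (gp _))
    (polynomial_funM (fp _) (gp _))) => y; rewrite mxE.
Qed.

Lemma polynomial_map_Smx (f : 'rV[L]_N -> 'rV[L]_3) :
  polynomial_map f -> polynomial_map (fun y => f y *m Smx L).
Proof.
move=> fp m.
apply: polynomial_fun_eq (polynomial_funM (fp m) (polynomial_funC _ _)) => y.
by rewrite mul_mx_diag mxE.
Qed.

Lemma polynomial_map_w (v : 'rV[L]_N -> nat -> 'rV[L]_3) j :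
  (forall i, polynomial_map (v^~ i)) -> polynomial_map (fun y => w (v y) j).
Proof.
move=> vp; elim: j => [|j IH]; first exact: polynomial_mapC.
rewrite /=; case: (j == 1%N); first exact: polynomial_map_cross.
by apply: polynomial_map_cross => //; exact: polynomial_map_Smx.
Qed.

Lemma polynomial_map_u (v : 'rV[L]_N -> nat -> 'rV[L]_3) j :
  (forall i, polynomial_map (v^~ i)) -> polynomial_map (fun y => u (v y) j).
Proof.
move=> vp; rewrite /u; case: (j == 1%N); first exact: vp.
by apply: polynomial_map_Smx; exact: polynomial_map_w.
Qed.

Lemma zeros_closed n (f : 'rV[L]_N -> 'rV[L]_n) :
  polynomial_map f -> zariski_closed [set x | f x = 0].
Proof.
move=> /choice[P fP]; exists (range P); apply/seteqP; split=> x /=.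
  by move=> fx _ [m _ <-]; rewrite -fP fx mxE.
by move=> Px; apply/rowP => m; rewrite mxE fP; apply: Px; exists m.
Qed.

End PolynomialVectors.

(** * Coordinate blocks *)
Section Blocks.
Variables (L : fieldType) (k : nat).
Implicit Types (x : 'rV[L]_(k * 3)) (v : nat -> 'rV[L]_3).

Definition block x i : 'rV[L]_3 :=
  if insub i.-1 is Some i' then row (i' : 'I_k) (vec_mx x) else 0.

Definition of_blocks v : 'rV[L]_(k * 3) := mxvec (\matrix_(i < k) v i.+1).

Lemma blockE x (i : 'I_k) c : block x i.+1 0 c = x 0 (mxvec_index i c).
Proof. by rewrite /block valK !mxE. Qed.

Lemma blockD x y i : block (x + y) i = block x i + block y i.
Proof. by rewrite /block; case: insub => [i'|]; rewrite ?addr0 // !linearD. Qed.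

Lemma blockZ t x i : block (t *: x) i = t *: block x i.
Proof. by rewrite /block; case: insub => [i'|]; rewrite ?scaler0 // !linearZ. Qed.

Lemma block_of_blocks v i : (0 < i <= k)%N -> block (of_blocks v) i = v i.
Proof.
case: i => // i /andP[_ ik]; apply/rowP => c.
by rewrite (blockE _ (Ordinal ik)) mxvecE mxE.
Qed.

Lemma eq_from_block x y :
  (forall i, (0 < i <= k)%N -> block x i = block y i) -> x = y.
Proof.
move=> xy; apply/rowP => m; case/mxvec_indexP: m => i c.
by rewrite -!blockE xy ?ltn_ord.
Qed.

Lemma polynomial_map_block i : polynomial_map (block^~ i).
Proof.
move=> c; case: (ltnP i.-1 k) => [ik|ki]; last first.
  apply: polynomial_fun_eq (polynomial_funC _ 0) => x.
  by rewrite /block insubF ?mxE // ltnNge ki.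
pose m := mxvec_index (Ordinal ik) c.
apply: polynomial_fun_eq (polynomial_fun_coord _ m) => x.
by rewrite /block insubT !mxE.
Qed.

Lemma polynomial_map_of_blocks N (v : 'rV[L]_N -> nat -> 'rV[L]_3) :
  (forall i, polynomial_map (v^~ i)) -> polynomial_map (fun y => of_blocks (v y)).
Proof.
move=> vp m; case/mxvec_indexP: m => i c.
by apply: polynomial_fun_eq (vp i.+1 c) => y; rewrite mxvecE mxE.
Qed.

Lemma forget_block_eqP (i : 'I_k) x y :
  forget_block i x = forget_block i y <->
  forall l, (0 < l <= k)%N -> l != i.+1 -> block x l = block y l.
Proof.
split=> [/(can_inj mxvecK) xy [//|l] lk li | xy].
  have neq : i != Ordinal (lk : (l < k)%N).
    by apply: contraNneq li => ->.
  have [l' ll' _] := unlift_some neq.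
  apply/rowP => c; rewrite !(blockE _ (Ordinal lk)).
  have := congr1 (fun A : 'M_(_, _) => A l' c) xy; rewrite !mxE.
  by rewrite /= -ll'.
congr mxvec; apply/matrixP => l c; rewrite !mxE -!blockE xy ?ltn_ord //.
by rewrite eqSS eq_sym; exact: neq_lift.
Qed.

(** Being a union of fibres amounts to being saturated for the equivalence
    relation of having the same image. *)
Lemma involves_blockP (i : 'I_k) (Z : set 'rV[L]_(k * 3)) :
  involves_block i Z <->
  exists x y, [/\ forget_block i x = forget_block i y, Z x & ~ Z y].
Proof.
split=> [invZ|[x [y [xy Zx nZy]]] [B ZB]]; last first.
  by apply: nZy; move: Zx; rewrite ZB => -[z Bz /= xz]; exists z; rewrite //= -xy.
apply: contrapT => sat; apply: invZ; exists (forget_block i @` Z).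
apply/seteqP; split=> [x Zx|x [_ [y Zy <-]] /= xy].
  by exists (forget_block i x) => //; exists x.
by apply: contrapT => nZx; apply: sat; exists y, x.
Qed.

End Blocks.

Arguments of_blocks {L} k v.

(** * The locus and its components *)

(** The recursion commutes with ring morphisms, in particular with the
    evaluation of polynomials at x. *)
Lemma vanishing_locusE (F L : fieldType) (iota : {rmorphism F -> L}) k :
  vanishing_locus iota (idealI F k) =
  [set x : 'rV[L]_(k * 3) | w (block x) k = 0].
Proof.
apply/seteqP; split=> x /=; pose ev := [the {rmorphism _ -> _} of
    meval (x 0) \o map_mpoly iota].
all: have evw : map_mx ev (w (@var_block F k) k) = w (block x) k.
1,3: rewrite w_map; congr w; apply/funext => i; apply/rowP => c;
  rewrite /block !mxE; case: insub => [i'|]; rewrite ?rmorph0 ?mxE //=;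
  by rewrite map_mpolyX mevalXU.
- move=> Vx; apply/rowP => c; rewrite -evw mxE [RHS]mxE.
  apply: Vx; exists (w (@var_block F k) k 0 c) => //.
  exists (delta_mx 0 c); rewrite (bigD1 c) //= mxE !eqxx mul1r big1 ?addr0 //.
  by move=> i /negPf ic; rewrite mxE ic mul0r.
- move=> wx _ [_ [a ->] <-]; rewrite -[LHS]/(ev _) rmorph_sum big1 // => c _.
  rewrite rmorphM /=; have := congr1 (fun A : 'rV_3 => A 0 c) evw.
  by rewrite /= wx !mxE /= => ->; rewrite mulr0.
Qed.

Section Components.
Variables (L : closedFieldType) (k : nat).
Implicit Types (x : 'rV[L]_(k * 3)).

Definition stratum j : set 'rV[L]_(k * 3) :=
  [set x | exists t, block x j = t *: u (block x) j.-1].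

Definition component j := zclosure (stratum j).

Lemma component_closed j : zariski_closed (component j).
Proof. exact: zclosure_closed. Qed.

Lemma component_w_eq0 j x : (1 < j)%N -> component j x -> w (block x) j = 0.
Proof.
move=> j1; apply: (zclosure_min (A := [set x | w (block x) j = 0])).
  by apply: zeros_closed; apply: polynomial_map_w => i; exact: polynomial_map_block.
case: j j1 => // -[//|j] _ {}x [t xj].
suff: w (block x) j.+2 = 0 by [].
by rewrite (@wS _ _ j.+1) // xj cross_scale.
Qed.

(** The point obtained by replacing v_1 = 0 with s v_2 lies in stratum 2 for
    every s <> 0; a polynomial that vanishes at all of them also vanishes at
    s = 0. *)
Lemma component2_first_block_eq0 x : (1 < k)%N -> block x 1 = 0 -> component 2 x.
Proof.
move=> k1 x1 p p0.
pose d := of_blocks k (fun i => if i == 1%N then block x 2 else 0).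
have [r rE] := meval_line p x d.
have r0 t : t != 0 -> r.[t] = 0.
  move=> t0; rewrite rE; apply: p0; exists t^-1.
  rewrite /u /= !blockD !blockZ !block_of_blocks ?(ltnW k1) //= x1 add0r.
  by rewrite scaler0 addr0 scalerA mulVf // scale1r.
have [r00|] := eqVneq r 0; first by rewrite -[x]addr0 -(scale0r d) -rE r00 horner0.
(* The factor 'X rules out the non-root t = 0, where r is not known to vanish. *)
move=> rn0; have /closed_nonrootP[t] : r * 'X != 0.
  by rewrite mulf_neq0 // polyX_eq0.
rewrite /root hornerM hornerX mulf_eq0 negb_or => /andP[rt t0].
by rewrite r0 ?eqxx in rt.
Qed.

Lemma component_cover x : (1 < k)%N -> w (block x) k = 0 ->
  exists2 j, (1 < j <= k)%N & component j x.
Proof.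
move=> k1 /(w_eq0_split k1)[j jk [xj|[_ x1]]].
  by exists j => //; apply: sub_zclosure.
by exists 2; rewrite ?k1 //; exact: component2_first_block_eq0.
Qed.

Lemma mxvec_index_inj (i j : 'I_k) (c d : 'I_3) :
  mxvec_index i c = mxvec_index j d -> (i, c) = (j, d).
Proof. by move=> /cast_ord_inj/enum_rank_inj. Qed.

Definition off_block (j : 'I_k) : seq 'I_(k * 3) :=
  enum [predC codom (@mxvec_index k 3 j)].

Lemma mem_off_block (i j : 'I_k) c : (mxvec_index i c \in off_block j) = (i != j).
Proof.
rewrite mem_enum !inE; congr negb.
apply/codomP/eqP => [[c' e]|->]; last by exists c.
by have [] := mxvec_index_inj e.
Qed.

Lemma size_off_block j : size (off_block j) = (3 * k - 3)%N.
Proof.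
have := cardC (mem (codom (@mxvec_index k 3 j))).
rewrite card_codom; last first.
  by move=> c c' /mxvec_index_inj[].
by rewrite !card_ord -cardE (mulnC 3) => /(congr1 (subn^~ 3)); rewrite addKn.
Qed.

Section Parametrization.
Variable j : 'I_k.
Let s := off_block j.

Definition base_point (y : 'rV[L]_(size s).+1) : 'rV[L]_(k * 3) :=
  \row_m (if m \in s then y 0 (inord (index m s)) else 0).

(** Blocks are numbered from 1, so the ordinal j stands for block j.+1.  The last
    entry of y is the factor t; the others are the coordinates outside that
    block. *)
Definition parametrization (y : 'rV[L]_(size s).+1) : 'rV[L]_(k * 3) :=
  of_blocks k (update (block (base_point y)) j.+1
    (y 0 ord_max *: u (block (base_point y)) j)).

Lemma parametrization_polynomial : polynomial_map parametrization.
Proof.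
have bp i : polynomial_map (fun y => block (base_point y) i).
  move=> c; have bpm m : polynomial_fun (fun y => base_point y 0 m).
    have [ms|ms] := boolP (m \in s).
      pose l := inord (index m s) : 'I_(size s).+1.
      apply: polynomial_fun_eq (polynomial_fun_coord _ l) => y.
      by rewrite mxE ms.
    apply: polynomial_fun_eq (polynomial_funC _ 0) => y.
    by rewrite mxE (negPf ms).
  have [p pE] := @polynomial_map_block L k i c.
  by apply: polynomial_fun_eq (polynomial_fun_comp p bpm) => y; rewrite pE.
apply: polynomial_map_of_blocks => i; rewrite /update.
case: (i == j.+1); last exact: bp.
apply: polynomial_mapZ; first exact: polynomial_fun_coord.
exact: polynomial_map_u.
Qed.

Lemma range_parametrization : (0 < j)%N -> range parametrization = stratum j.+1.
Proof.
move=> j0; apply/seteqP; split=> [_ [y _ <-]|x [t xj]].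
  exists (y 0 ord_max); rewrite block_of_blocks ?ltn_ord // /update eqxx.
  congr (_ *: _); apply: u_ext => // i /andP[i0 ij].
  rewrite block_of_blocks ?i0 ?(leq_trans ij) ?(ltnW (ltn_ord j)) //.
  by rewrite /update ltn_eqF.
pose y : 'rV[L]_(size s).+1 :=
  \row_l (if l == ord_max then t else x 0 (nth (mxvec_index j 0) s l)).
have block_y i : (0 < i <= k)%N -> i != j.+1 -> block (base_point y) i = block x i.
  case: i => // i /andP[_ ik] ij; apply/rowP => c.
  rewrite !(blockE _ (Ordinal ik)).
  set m := mxvec_index _ c.
  have ms : m \in s by rewrite mem_off_block.
  rewrite mxE ms mxE.
  have lti : (index m s < size s)%N by rewrite index_mem.
  have -> : (inord (index m s) == ord_max :> 'I_(size s).+1) = false.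
    by apply/negbTE; rewrite -val_eqE /= inordK ?ltn_eqF // ltnW.
  by rewrite inordK ?nth_index // ltnW.
exists y => //; apply: eq_from_block => i ik; rewrite block_of_blocks // /update.
case: eqP => [->|/eqP ij]; last exact: block_y.
rewrite xj mxE eqxx; congr (_ *: _); apply: u_ext => // l /andP[l0 lj].
by rewrite block_y ?l0 ?ltn_eqF // (leq_trans lj) // ltnW.
Qed.

Lemma component_irreducible : (0 < j)%N -> irreducible (component j.+1).
Proof.
move=> j0; rewrite /component -range_parametrization //.
by apply: irreducible_zclosure_range; exact: parametrization_polynomial.
Qed.

Lemma mem_stratum_update v : (0 < j)%N ->
  stratum j.+1 (of_blocks k (update v j.+1 (u v j))).
Proof.
move=> j0; exists 1; rewrite scale1r block_of_blocks ?ltn_ord // /update eqxx.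
apply: u_ext => // i /andP[i0 ij].
rewrite block_of_blocks ?i0 ?(leq_trans ij) ?(ltnW (ltn_ord j)) //.
by rewrite ltn_eqF.
Qed.

(** The subspace where block j.+1 is zero lies in the stratum (take t = 0); its
    coordinate flag has length 3 * k - 3, and the component comes on top. *)
Lemma component_dimension :
  (0 < j)%N -> has_dimension (component j.+1) (3 * k - 2).
Proof.
move=> j0; have sizes : (size s).+1 = (3 * k - 2)%N.
  rewrite size_off_block; have := ltn_ord j; lia.
split; last first.
  move=> T e; rewrite -sizes /component -range_parametrization //.
  by apply: chain_length_le; exact: parametrization_polynomial.
rewrite -sizes; apply: coord_flag_chain.
- exact: enum_uniq.
- exact: component_closed.
- exact: component_irreducible.
have in_s x : (forall m, m \notin s -> x 0 m = 0) <-> block x j.+1 = 0.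
  split=> [x0|xj m].
    by apply/rowP => c; rewrite blockE mxE x0 // mem_off_block eqxx.
  case/mxvec_indexP: m => i c; rewrite mem_off_block negbK => /eqP ->.
  by rewrite -blockE xj mxE.
split=> [x /in_s xj|sub].
  by apply: sub_zclosure; exists 0; rewrite scale0r.
have [v nz] := @u_neq0 L j j0.
have /sub/in_s := sub_zclosure (mem_stratum_update v j0).
by rewrite block_of_blocks ?ltn_ord // /update eqxx => /eqP; rewrite (negPf nz).
Qed.

(** For i <= j, a point of the stratum is modified in block i.+1 so that
    w_(j+1) no longer vanishes.  For i > j, a polynomial p that vanishes on the stratum
    does so after translation by y - x, because this only affects
    block i.+1. *)
Lemma component_involves (i : 'I_k) : (0 < j)%N ->
  involves_block i (component j.+1) <-> (i <= j)%N.
Proof.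
move=> j0; split; last first.
  rewrite leq_eqVlt => /orP[/eqP ij|ij]; apply/involves_blockP.
    have [v nz] := @u_neq0 L j j0; have [b nzb] := cross_neq0 nz.
    exists (of_blocks k (update v j.+1 (u v j))).
    exists (of_blocks k (update v j.+1 b)).
    split; last 1 first.
    - move=> /component_w_eq0 => /(_ j0)/eqP; apply/negP.
      rewrite wS // block_of_blocks ?ltn_ord // [update v j.+1 b j.+1]/update eqxx.
      rewrite (u_ext (v' := v)) // => l /andP[l0 lj].
      rewrite block_of_blocks ?l0 ?(leq_trans lj) ?(ltnW (ltn_ord j)) //.
      by rewrite /update ltn_eqF.
    - apply/forget_block_eqP => l lk; rewrite ij => /negPf lj.
      by rewrite !block_of_blocks // /update lj.
    - by apply: sub_zclosure; exact: mem_stratum_update.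
  have [v [a nz]] := @u_varies L i.+1 j ij.
  exists (of_blocks k (update v j.+1 (u v j))).
  exists (of_blocks k (update (update v i.+1 a) j.+1 (u v j))); split.
  - apply/forget_block_eqP => l lk /negPf li.
    by rewrite !block_of_blocks // /update li.
  - by apply: sub_zclosure; exact: mem_stratum_update.
  - move=> /component_w_eq0 => /(_ j0); rewrite wS // block_of_blocks ?ltn_ord //.
    rewrite [update _ _ _ j.+1]/update eqxx.
    rewrite (u_ext (v' := update v i.+1 a)) //; last first.
      move=> l /andP[l0 lj].
      rewrite block_of_blocks ?l0 ?(leq_trans lj) ?(ltnW (ltn_ord j)) //.
      by rewrite {1}/update ltn_eqF.
    by move=> c0; rewrite cross_anticomm c0 oppr0 eqxx in nz.
move=> /involves_blockP[x [y [xy Zx nZy]]]; rewrite leqNgt; apply/negP => ji.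
apply: nZy => p p0.
have [q qE] : polynomial_fun (fun z : 'rV[L]_(k * 3) => p.@[(z + (y - x)) 0]).
  apply: polynomial_fun_comp => m.
  apply: polynomial_fun_eq (polynomial_funD (polynomial_fun_coord _ m)
    (polynomial_funC _ ((y - x) 0 m))) => z.
  by rewrite [RHS]mxE.
rewrite -[y](subrKC x) qE; apply: Zx => z [t zj]; rewrite -qE; apply: p0.
have yx l : (0 < l <= j.+1)%N -> block (z + (y - x)) l = block z l.
  move=> /andP[l0 lj]; have /forget_block_eqP xyl := xy.
  rewrite -[y - x]addrC -scaleN1r !blockD blockZ -xyl ?scaleN1r ?addNr ?addr0 //.
    by rewrite l0 (leq_trans lj).
  by rewrite ltn_eqF // (leq_ltn_trans lj).
exists t; rewrite yx ?leqnn // zj; congr (_ *: _); apply: u_ext => // l /andP[l0 lj].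
by rewrite yx // l0 leqW.
Qed.

End Parametrization.
End Components.

Theorem theorem23 (F : fieldType) (charF : 2%N \notin [pchar F])
    (Fbar : closedFieldType) (iota : {rmorphism F -> Fbar})
    (Fbar_closure : is_algebraic_closure iota) (k : nat) (hk : (2 <= k)%N) :
  let V := vanishing_locus iota (idealI F k) in
  [/\ irreducible_components V #= `I_(k - 1),
      forall Z, irreducible_components V Z -> has_dimension Z (3 * k - 2) &
      exists2 C : nat -> set 'rV[Fbar]_(k * 3),
        set_bij [set j | (2 <= j <= k)%N] (irreducible_components V) C &
        forall j, (2 <= j <= k)%N ->
        forall i : 'I_k, involves_block i (C j) <-> (i.+1 <= j)%N].
Proof.
move=> V; have VE : V = [set x | w (block x) k = 0] := vanishing_locusE iota k.
pose C := @component Fbar k; pose J := [set j | (2 <= j <= k)%N].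
have ordJ j : J j -> exists2 j' : 'I_k, (0 < j')%N & j = j'.+1.
  case: j => [//|j] /andP[j0 jk].
  by exists (Ordinal jk).
have clC j : zariski_closed (C j) by exact: component_closed.
have irrC j : J j -> irreducible (C j).
  by case/ordJ => j' j'0 ->; exact: component_irreducible.
have dimC j : J j -> has_dimension (C j) (3 * k - 2).
  by case/ordJ => j' j'0 ->; exact: component_dimension.
have invC j (i : 'I_k) : J j -> involves_block i (C j) <-> (i.+1 <= j)%N.
  by case/ordJ => j' j'0 ->; exact: component_involves.
have CV j : J j -> C j `<=` V.
  move=> Jj x Cx; have /andP[j1 _] := Jj; rewrite VE.
  exact: w_eq0_leq Jj (component_w_eq0 j1 Cx).
have cover Z : irreducible Z -> Z `<=` V -> exists2 j, J j & Z `<=` C j.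
  move=> irrZ ZV.
  have [|j] := irreducible_sub_cover (s := seq.iota 2 (k - 1)) irrZ clC.
    move=> x /ZV; rewrite VE => /(component_cover hk)[j jk Cx].
    by exists j; rewrite // mem_iota; move: jk; lia.
  by rewrite mem_iota => jk ZC; exists j => //; rewrite /J /=; lia.
have Cinj i j : J i -> J j -> C i `<=` C j -> C i = C j.
  by move=> Ji Jj; exact: has_dimension_inj (clC i) (clC j) (irrC j Jj)
    (dimC i Ji) (dimC j Jj).
have bijC : set_bij J (irreducible_components V) C.
  split.
  - move=> j Jj; split; [exact: CV|exact: irrC|move=> Z ZV irrZ CZ].
    have [i Ji ZC] := cover Z irrZ ZV.
    have CC := Cinj j i Jj Ji (subset_trans CZ ZC).
    by apply/seteqP; split=> //; rewrite CC.
  - move=> i j /set_mem Ji /set_mem Jj CC.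
    wlog ltij : i j Ji Jj CC / (i < j)%N.
      move=> H; case: (ltngtP i j) => // ij; first exact: H.
      by apply/esym/H.
    have [j' _ jj'] := ordJ j Jj.
    have : involves_block j' (C j) by apply/(invC _ _ Jj); rewrite jj'.
    by rewrite -CC => /(invC _ _ Ji); rewrite -jj' leqNgt ltij.
  - move=> Z [ZV irrZ maxZ]; have [j Jj ZC] := cover Z irrZ ZV.
    by exists j => //; apply: maxZ => //; [exact: CV|exact: irrC].
split.
- have bijV : set_bij `I_(k - 1) (irreducible_components V) (fun n => C n.+2).
    have [fC iC sC] := bijC; split.
    + by move=> n /= nk; apply: fC; rewrite /J /=; lia.
    + move=> m n /set_mem /= mk /set_mem /= nk CC.
      suff [] : m.+2 = n.+2 by [].
      by apply: iC => //; rewrite inE /J /=; lia.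
    + move=> Z /sC[j Jj <-]; exists j.-2; first by move: Jj; rewrite /J /=; lia.
      by case: j Jj => [|[|j]].
  by apply/card_esym/card_set_bijP; eexists; exact: bijV.
- move=> Z; have [_ _ sC] := bijC => /sC[j Jj <-]; exact: dimC.
- by exists C => // j Jj i; exact: invC.
Qed.
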